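(* Fix $\theta\in(0,\pi/2)$ and, for $\lambda>0$, let $P_\lambda=(\lambda\cos\theta,\lambda\sin\theta,0)\in\mathrm{SOL}$. Let $d$ denote the Riemannian distance of $\mathrm{SOL}$ and let $0=(0,0,0)$. Then $$d(0,P_\lambda)=4\log\lambda+O(1)\quad\text{as }\lambda\to\infty,$$ where the error term is uniformly bounded in $\lambda$, with a bound depending only on $\theta$.
   Context: $\mathrm{SOL}$ is the manifold $\mathbb{R}^3$ with coordinates $(x,y,z)$ endowed with the complete Riemannian metric $ds^2=e^{-2z}dx^2+e^{2z}dy^2+dz^2$ (which is left-invariant for the group law $(x_1,y_1,z_1)\ast(x_2,y_2,z_2)=(x_1+e^{z_1}x_2,\;y_1+e^{-z_1}y_2,\;z_1+z_2)$). The distance $d(p,q)$ is the infimum of the lengths of piecewise smooth curves from $p$ to $q$. *)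

(* Defs.v *)
From Stdlib Require Import Reals.
From Coquelicot Require Import Coquelicot.

Open Scope R_scope.

(* Points are given by their global coordinates (x, y, z); tangent vectors by
   their components in the coordinate frame, so they have the same type. *)
Definition SOL : Type := (R * R * R)%type.

Definition xcoord (p : SOL) : R := fst (fst p).
Definition ycoord (p : SOL) : R := snd (fst p).
Definition zcoord (p : SOL) : R := snd p.

(* Metric tensor ds^2 = e^{-2z} dx^2 + e^{2z} dy^2 + dz^2. *)
Definition sol_metric (p v w : SOL) : R :=
  exp (- 2 * zcoord p) * (xcoord v * xcoord w)
  + exp (2 * zcoord p) * (ycoord v * ycoord w)
  + zcoord v * zcoord w.

Definition sol_norm (p v : SOL) : R := sqrt (sol_metric p v v).

(* C^infinity on the closed interval [a, b]: restriction of a function that is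
   C^infinity on an open interval containing [a, b]. *)
Definition smooth_on (f : R -> R) (a b : R) : Prop :=
  exists (g : R -> R) (eps : R),
    0 < eps /\
    (forall (n : nat) (t : R), a - eps < t < b + eps -> ex_derive_n g n t) /\
    (forall t : R, a <= t <= b -> f t = g t).

Definition smooth_curve_on (gamma : R -> SOL) (a b : R) : Prop :=
  smooth_on (fun t => xcoord (gamma t)) a b /\
  smooth_on (fun t => ycoord (gamma t)) a b /\
  smooth_on (fun t => zcoord (gamma t)) a b.

(* Smooth on each closed piece of a finite partition
   a = t 0 < t 1 < ... < t n = b.  Continuity on [a, b] is automatic: adjacent
   closed pieces share the value of gamma at their common endpoint. *)
Definition piecewise_smooth (gamma : R -> SOL) (a b : R) : Prop :=
  exists (n : nat) (t : nat -> R),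
    t 0%nat = a /\ t n = b /\
    (forall i : nat, (i < n)%nat ->
       t i < t (S i) /\ smooth_curve_on gamma (t i) (t (S i))).

Definition velocity (gamma : R -> SOL) (t : R) : SOL :=
  (Derive (fun s => xcoord (gamma s)) t,
   Derive (fun s => ycoord (gamma s)) t,
   Derive (fun s => zcoord (gamma s)) t).

(* For a piecewise smooth curve on [a, b], the velocity is meaningless only at
   the finitely many points of the partition (a and b included), which do not
   affect the integral. *)
Definition curve_length (gamma : R -> SOL) (a b : R) : R :=
  RInt (fun t => sol_norm (gamma t) (velocity gamma t)) a b.

Definition is_length_between (p q : SOL) (L : R) : Prop :=
  exists (gamma : R -> SOL) (a b : R),
    a < b /\ piecewise_smooth gamma a b /\
    gamma a = p /\ gamma b = q /\ L = curve_length gamma a b.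

(* The set of lengths is nonempty and bounded below by 0, so its greatest lower
   bound in Rbar is finite and [real] only reads off its value. *)
Definition sol_dist (p q : SOL) : R := real (Glb_Rbar (is_length_between p q)).

(* Main.v *)
Require Import Defs.
From Stdlib Require Import Reals Lra Lia.
From Coquelicot Require Import Coquelicot.

(** Lower bound.  The exponential growth of the metric makes the planes
    y = const and x = const hyperbolic: with h = e^z the first is the upper
    half-plane dx^2/h^2 + dh^2/h^2, and with k = e^-z so is the second in
    (y, k).  On the upper half-plane ln ((x^2 + h^2) / h) has gradient of norm
    one and grows by about 2 ln x from (0, 1) to (x, 1).  The sum of the two
    functions would grow by the required 4 ln lambda, but each of them uses up
    the dz^2 term, so that sum is not 1-Lipschitz.  Replacing h by 1 + e^z and
    k by 1 + e^-z repairs this: the first gradient now has norm at most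
    e^z / (1 + e^z), the second at most e^-z / (1 + e^-z), and these two
    numbers add up to 1 at every height.  Hence [potential] is 1-Lipschitz for
    the metric of SOL ([potential_diff_le_norm]), so its increment bounds the
    length of every curve from below ([potential_le_length]).  Since h and k
    both equal 2 at height 0, the shift costs only a bounded amount there
    ([length_ge_ln]).

    Upper bound.  At height l = ln lambda a displacement of order lambda along
    x has bounded length, and likewise along y at height -l.  Rising from 0 to
    l, moving along x, descending to -l, moving along y and rising back to 0
    costs 4 l plus a bounded amount ([length_of_five_segments]). *)

Open Scope R_scope.

(** * The 1-Lipschitz potential *)

(** Up to sign, the Busemann function at the ideal boundary point 0 of the
    upper half-plane with coordinates (x, h). *)
Definition busemann (x h : R) : R := ln ((x ^ 2 + h ^ 2) / h).

Definition potential (p : SOL) : R :=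
  busemann (xcoord p) (1 + exp (zcoord p))
  + busemann (ycoord p) (1 + exp (- zcoord p)).

(** The factors of dx and dh in the numerator are written so that their squares
    visibly add up to 1. *)
Definition busemann_diff (x h dx dh : R) : R :=
  (2 * x * h / (x ^ 2 + h ^ 2) * dx
   + (h ^ 2 - x ^ 2) / (x ^ 2 + h ^ 2) * dh) / h.

Definition potential_diff (p v : SOL) : R :=
  busemann_diff (xcoord p) (1 + exp (zcoord p))
    (xcoord v) (exp (zcoord p) * zcoord v)
  + busemann_diff (ycoord p) (1 + exp (- zcoord p))
      (ycoord v) (- exp (- zcoord p) * zcoord v).

Lemma half_plane_pos (x h : R) : 0 < h -> 0 < x ^ 2 + h ^ 2.
Proof. intros Hh; nra. Qed.

(** A Busemann function has a gradient of norm one, so this is the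
    Cauchy-Schwarz inequality for a unit covector. *)
Lemma busemann_diff_le (x h dx dh N : R) :
  0 < h -> 0 <= N -> dx ^ 2 + dh ^ 2 <= N ^ 2 ->
  busemann_diff x h dx dh <= N / h.
Proof.
  intros Hh HN Hle; unfold busemann_diff.
  pose proof (half_plane_pos x h Hh) as HD.
  apply Rmult_le_compat_r; [left; now apply Rinv_0_lt_compat|].
  set (s := 2 * x * h / (x ^ 2 + h ^ 2)).
  set (c := (h ^ 2 - x ^ 2) / (x ^ 2 + h ^ 2)).
  assert (Hsc : s ^ 2 + c ^ 2 = 1) by (unfold s, c; field; lra).
  apply Rsqr_incr_0_var; [unfold Rsqr|exact HN].
  (* Lagrange's identity *)
  assert (Hid : (s * dx + c * dh) * (s * dx + c * dh)
    = (s ^ 2 + c ^ 2) * (dx ^ 2 + dh ^ 2) - (s * dh - c * dx) ^ 2) by ring.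
  rewrite Hid, Hsc; pose proof (pow2_ge_0 (s * dh - c * dx)); lra.
Qed.

Lemma exp_double (u : R) : exp (2 * u) = exp u ^ 2.
Proof. replace (2 * u) with (u + u) by ring; rewrite exp_plus; ring. Qed.

Lemma sol_metric_nonneg (p v : SOL) : 0 <= sol_metric p v v.
Proof.
  unfold sol_metric.
  pose proof (exp_pos (- 2 * zcoord p)); pose proof (exp_pos (2 * zcoord p)).
  nra.
Qed.

(** In the (x, h) half-plane with h = 1 + e^z the vector v has Euclidean length
    at most e^z |v|, hence hyperbolic length at most e^z / (1 + e^z) |v|; the
    (y, k) half-plane gives the complementary fraction of |v|. *)
Lemma potential_diff_le_norm (p v : SOL) : potential_diff p v <= sol_norm p v.
Proof.
  unfold potential_diff.
  set (N := sol_norm p v).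
  assert (HN : 0 <= N) by apply sqrt_pos.
  assert (HN2 : N ^ 2 = sol_metric p v v)
    by (apply pow2_sqrt, sol_metric_nonneg).
  unfold sol_metric in HN2.
  destruct p as [[x y] z], v as [[vx vy] vz].
  unfold xcoord, ycoord, zcoord in *; cbn [fst snd] in *.
  replace (- 2 * z) with (2 * - z) in HN2 by ring.
  rewrite !exp_double in HN2.
  pose proof (exp_pos z) as Ha; pose proof (exp_pos (- z)) as Hb.
  assert (Hab : exp z * exp (- z) = 1)
    by (rewrite <- exp_plus, Rplus_opp_r; apply exp_0).
  set (a := exp z) in *; set (b := exp (- z)) in *; clearbody a b N.
  assert (Hx : vx ^ 2 + (a * vz) ^ 2 <= (a * N) ^ 2).
  { replace ((a * N) ^ 2) with (a ^ 2 * N ^ 2) by ring; rewrite HN2.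
    replace (a ^ 2 * (b ^ 2 * (vx * vx) + a ^ 2 * (vy * vy) + vz * vz))
      with ((a * b) ^ 2 * vx ^ 2 + (a * a * vy) ^ 2 + (a * vz) ^ 2) by ring.
    rewrite Hab; pose proof (pow2_ge_0 (a * a * vy)); lra. }
  assert (Hy : vy ^ 2 + (- b * vz) ^ 2 <= (b * N) ^ 2).
  { replace ((b * N) ^ 2) with (b ^ 2 * N ^ 2) by ring; rewrite HN2.
    replace (b ^ 2 * (b ^ 2 * (vx * vx) + a ^ 2 * (vy * vy) + vz * vz))
      with ((a * b) ^ 2 * vy ^ 2 + (b * b * vx) ^ 2 + (- b * vz) ^ 2) by ring.
    rewrite Hab; pose proof (pow2_ge_0 (b * b * vx)); lra. }
  apply (busemann_diff_le x (1 + a)) in Hx; [|lra|nra].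
  apply (busemann_diff_le y (1 + b)) in Hy; [|lra|nra].
  replace N with (a * N / (1 + a) + b * N / (1 + b)); [lra|].
  replace b with (/ a) by (field_simplify_eq; lra).
  field; lra.
Qed.

Lemma is_derive_busemann (x h : R -> R) (t dx dh : R) :
  0 < h t -> is_derive x t dx -> is_derive h t dh ->
  is_derive (fun s => busemann (x s) (h s)) t (busemann_diff (x t) (h t) dx dh).
Proof.
  intros Hh Hx Hd; unfold busemann, busemann_diff.
  pose proof (half_plane_pos (x t) (h t) Hh) as HD.
  auto_derive.
  - repeat split; try (now exists dx); try (now exists dh); try lra.
    now apply Rdiv_lt_0_compat; cbn in *.
  - change (Derive (fun s => x s) t) with (Derive x t).
    change (Derive (fun s => h s) t) with (Derive h t).
    rewrite (is_derive_unique x t dx Hx), (is_derive_unique h t dh Hd).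
    field; repeat split; nra.
Qed.

Definition curve (x y z : R -> R) (t : R) : SOL := (x t, y t, z t).

Lemma is_derive_potential (x y z : R -> R) (t dx dy dz : R) :
  is_derive x t dx -> is_derive y t dy -> is_derive z t dz ->
  is_derive (fun s => potential (curve x y z s)) t
    (potential_diff (curve x y z t) (dx, dy, dz)).
Proof.
  intros Hx Hy Hz.
  apply @is_derive_plus.
  - apply (is_derive_busemann x (fun s => 1 + exp (z s)));
      [pose proof (exp_pos (z t)); lra|exact Hx|].
    auto_derive; [now exists dz|].
    change (Derive (fun s => z s) t) with (Derive z t).
    rewrite (is_derive_unique z t dz Hz); unfold zcoord, curve; cbn; ring.
  - apply (is_derive_busemann y (fun s => 1 + exp (- z s)));
      [pose proof (exp_pos (- z t)); lra|exact Hy|].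
    auto_derive; [now exists dz|].
    change (Derive (fun s => z s) t) with (Derive z t).
    rewrite (is_derive_unique z t dz Hz); unfold zcoord, curve; cbn; ring.
Qed.

(** * Length bounds the increment of the potential *)

Definition speed (gamma : R -> SOL) (t : R) : R :=
  sol_norm (gamma t) (velocity gamma t).

Lemma Derive_ext_open (f g : R -> R) (a b t : R) :
  (forall s, a < s < b -> f s = g s) -> a < t < b -> Derive f t = Derive g t.
Proof.
  intros Heq [Hat Htb]; apply Derive_ext_loc.
  assert (He : 0 < Rmin (t - a) (b - t)) by (apply Rmin_glb_lt; lra).
  exists (mkposreal _ He); intros s Hs; apply Heq.
  unfold ball, AbsRing_ball in Hs; cbn in Hs.
  unfold AbsRing_ball, abs, minus, plus, opp in Hs; cbn in Hs.
  apply Rabs_def2 in Hs.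
  pose proof (Rmin_l (t - a) (b - t)); pose proof (Rmin_r (t - a) (b - t)); lra.
Qed.

(** Curves are known only on closed pieces, and at the ends of a piece their
    velocity is meaningless; speeds are therefore compared on open intervals,
    which is all that the Riemann integral sees. *)
Lemma speed_ext_open (gamma delta : R -> SOL) (a b t : R) :
  (forall s, a < s < b -> gamma s = delta s) -> a < t < b ->
  speed gamma t = speed delta t.
Proof.
  intros Heq Ht; unfold speed, velocity.
  rewrite (Heq t Ht).
  rewrite (Derive_ext_open (fun s => xcoord (gamma s)) (fun s => xcoord (delta s)) a b t),
    (Derive_ext_open (fun s => ycoord (gamma s)) (fun s => ycoord (delta s)) a b t),
    (Derive_ext_open (fun s => zcoord (gamma s)) (fun s => zcoord (delta s)) a b t);
    try exact Ht; try reflexivity; intros s Hs; now rewrite (Heq s Hs).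
Qed.

(** The part of smoothness that is used: it makes the velocity continuous. *)
Definition twice_derivable_on (f : R -> R) (a b : R) : Prop :=
  forall t, a <= t <= b -> ex_derive f t /\ ex_derive (Derive f) t.

Lemma smooth_on_extension (f : R -> R) (a b : R) :
  smooth_on f a b ->
  exists g, twice_derivable_on g a b /\ (forall t, a <= t <= b -> f t = g t).
Proof.
  intros (g & eps & Heps & Hd & Heq); exists g; split; [|exact Heq].
  intros t Ht; split; [apply (Hd 1%nat)|apply (Hd 2%nat)]; lra.
Qed.

Lemma continuous_speed (x y z : R -> R) (a b t : R) :
  twice_derivable_on x a b -> twice_derivable_on y a b ->
  twice_derivable_on z a b ->
  a <= t <= b -> continuous (speed (curve x y z)) t.
Proof.
  intros Hx Hy Hz Ht; destruct (Hx t Ht), (Hy t Ht), (Hz t Ht).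
  unfold speed, sol_norm.
  apply (continuous_comp _ sqrt); [|apply continuous_sqrt].
  unfold sol_metric, velocity, curve, xcoord, ycoord, zcoord; cbn [fst snd].
  apply (@ex_derive_continuous R_AbsRing R_NormedModule).
  auto_derive; tauto.
Qed.

Lemma continuous_potential_diff (x y z : R -> R) (a b t : R) :
  twice_derivable_on x a b -> twice_derivable_on y a b ->
  twice_derivable_on z a b ->
  a <= t <= b ->
  continuous (fun s => potential_diff (curve x y z s)
                         (Derive x s, Derive y s, Derive z s)) t.
Proof.
  intros Hx Hy Hz Ht; destruct (Hx t Ht), (Hy t Ht), (Hz t Ht).
  unfold potential_diff, busemann_diff, curve, xcoord, ycoord, zcoord.
  cbn [fst snd].
  apply (@ex_derive_continuous R_AbsRing R_NormedModule).
  pose proof (exp_pos (z t)); pose proof (exp_pos (- z t)).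
  auto_derive; repeat split; try assumption; nra.
Qed.

(** Integrate [potential_diff_le_norm] along the curve. *)
Lemma potential_le_length_twice_derivable (x y z : R -> R) (a b : R) :
  a < b ->
  twice_derivable_on x a b -> twice_derivable_on y a b ->
  twice_derivable_on z a b ->
  ex_RInt (speed (curve x y z)) a b /\
  potential (curve x y z b) - potential (curve x y z a)
    <= RInt (speed (curve x y z)) a b.
Proof.
  intros Hab Hx Hy Hz.
  assert (Hex : ex_RInt (speed (curve x y z)) a b).
  { apply (@ex_RInt_continuous R_CompleteNormedModule); intros t Ht.
    rewrite Rmin_left, Rmax_right in Ht by lra.
    now apply (continuous_speed x y z a b). }
  split; [exact Hex|].
  pose (dpot := fun s => potential_diff (curve x y z s)
                           (Derive x s, Derive y s, Derive z s)).
  assert (Hpot : is_RInt dpot a b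
            (potential (curve x y z b) - potential (curve x y z a))).
  { apply (@is_RInt_derive R_CompleteNormedModule (fun s => potential (curve x y z s)) dpot);
      intros t Ht; rewrite Rmin_left, Rmax_right in Ht by lra.
    - destruct (Hx t Ht), (Hy t Ht), (Hz t Ht).
      now apply is_derive_potential; apply Derive_correct.
    - now apply (continuous_potential_diff x y z a b). }
  rewrite <- (is_RInt_unique _ _ _ _ Hpot).
  apply RInt_le; [lra|now eexists; exact Hpot|exact Hex|].
  intros t _; apply potential_diff_le_norm.
Qed.

Lemma potential_le_length_smooth (gamma : R -> SOL) (a b : R) :
  a < b -> smooth_curve_on gamma a b ->
  ex_RInt (speed gamma) a b /\
  potential (gamma b) - potential (gamma a) <= RInt (speed gamma) a b.
Proof.
  intros Hab (Hx & Hy & Hz).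
  destruct (smooth_on_extension _ _ _ Hx) as (x & Dx & Ex).
  destruct (smooth_on_extension _ _ _ Hy) as (y & Dy & Ey).
  destruct (smooth_on_extension _ _ _ Hz) as (z & Dz & Ez).
  assert (Heq : forall t, a <= t <= b -> gamma t = curve x y z t).
  { intros t Ht; unfold curve; rewrite <- Ex, <- Ey, <- Ez by exact Ht.
    now destruct (gamma t) as [[? ?] ?]. }
  destruct (potential_le_length_twice_derivable x y z a b Hab Dx Dy Dz)
    as [Hex Hle].
  assert (Hsp : forall t, Rmin a b < t < Rmax a b ->
                  speed (curve x y z) t = speed gamma t).
  { rewrite Rmin_left, Rmax_right by lra; intros t Ht.
    apply (speed_ext_open _ _ a b); [|exact Ht].
    intros s Hs; symmetry; apply Heq; lra. }
  split; [now apply (ex_RInt_ext _ _ _ _ Hsp)|].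
  rewrite <- (RInt_ext _ _ _ _ Hsp), !Heq by lra; exact Hle.
Qed.

(** The integrability half makes lengths of consecutive pieces additive; without
    it [RInt] would carry no information. *)
Lemma potential_le_length (gamma : R -> SOL) (a b : R) :
  piecewise_smooth gamma a b ->
  ex_RInt (speed gamma) a b /\
  potential (gamma b) - potential (gamma a) <= curve_length gamma a b.
Proof.
  intros (n & t & <- & <- & Hpc); change (curve_length gamma) with (RInt (speed gamma)).
  induction n as [|n IH].
  - split; [apply ex_RInt_point|].
    rewrite RInt_point; unfold zero; cbn; lra.
  - destruct IH as [Hex Hle]; [intros i Hi; apply Hpc; lia|].
    destruct (Hpc n) as [Hlt Hsm]; [lia|].
    destruct (potential_le_length_smooth _ _ _ Hlt Hsm) as [Hex' Hle'].
    split; [now apply (ex_RInt_Chasles _ _ (t n))|].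
    rewrite <- (RInt_Chasles _ _ _ _ Hex Hex').
    change plus with Rplus; lra.
Qed.

(** * Curves made of segments *)

Definition affine_curve (q v : SOL) (b t : R) : SOL :=
  (xcoord q + (t - b) * xcoord v,
   ycoord q + (t - b) * ycoord v,
   zcoord q + (t - b) * zcoord v).

Lemma smooth_on_affine (f : R -> R) (a b c u v : R) :
  (forall t, a <= t <= b -> f t = u + (t - c) * v) -> smooth_on f a b.
Proof.
  intros Heq; exists (fun t => u + (t - c) * v), 1.
  split; [lra|split; [|exact Heq]].
  (* Every derivative of an affine function is affine, hence derivable. *)
  assert (Hn : forall n, exists p q, forall t,
             Derive_n (fun t => u + (t - c) * v) n t = p + t * q).
  { induction n as [|n (p & q & IH)].
    - exists (u - c * v), v; intros t; cbn; ring.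
    - exists q, 0; intros t; cbn; rewrite (Derive_ext _ _ _ IH).
      apply is_derive_unique; auto_derive; [easy|ring]. }
  intros [|n] t _; [exact I|].
  destruct (Hn n) as (p & q & Hpq).
  apply (ex_derive_ext (fun t => p + t * q)); [easy|auto_derive; easy].
Qed.

Lemma speed_affine_curve (q v : SOL) (b t : R) :
  speed (affine_curve q v b) t = sol_norm (affine_curve q v b t) v.
Proof.
  unfold speed; f_equal; unfold velocity, affine_curve, xcoord, ycoord, zcoord.
  destruct v as [[vx vy] vz]; cbn [fst snd].
  repeat f_equal; apply is_derive_unique; auto_derive; (easy || ring).
Qed.

(** Starting point for building curves one segment at a time with
    [is_length_between_extend]. *)
Lemma is_length_between_refl (p : SOL) : is_length_between p p 0.
Proof.
  exists (affine_curve p (0, 0, 0) 0), 0, 1.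
  split; [lra|split; [|split; [|split]]].
  - exists 1%nat, INR; repeat split; try (cbn; lra).
    + apply lt_INR; lia.
    + eapply smooth_on_affine; reflexivity.
    + eapply smooth_on_affine; reflexivity.
    + eapply smooth_on_affine; reflexivity.
  - destruct p as [[? ?] ?]; unfold affine_curve, xcoord, ycoord, zcoord; cbn.
    repeat f_equal; ring.
  - destruct p as [[? ?] ?]; unfold affine_curve, xcoord, ycoord, zcoord; cbn.
    repeat f_equal; ring.
  - change (curve_length ?g) with (RInt (speed g)).
    rewrite (RInt_ext _ (fun _ => 0)).
    + rewrite RInt_const; unfold scal; cbn; unfold mult; cbn; ring.
    + intros t _; rewrite speed_affine_curve.
      unfold sol_norm, sol_metric, xcoord, ycoord, zcoord; cbn.
      transitivity (sqrt 0); [f_equal; ring|apply sqrt_0].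
Qed.

Lemma partition_le (t : nat -> R) (n i : nat) :
  (forall j, (j < n)%nat -> t j < t (S j)) -> (i <= n)%nat -> t i <= t n.
Proof.
  intros Hlt Hi; induction n as [|n IH].
  - replace i with 0%nat by lia; lra.
  - destruct (Nat.eq_dec i (S n)) as [->|Hne]; [lra|].
    apply Rle_trans with (t n); [apply IH; [intros j Hj; apply Hlt|]; lia|].
    left; apply Hlt; lia.
Qed.

Lemma smooth_curve_on_ext (gamma delta : R -> SOL) (a b : R) :
  (forall t, a <= t <= b -> delta t = gamma t) ->
  smooth_curve_on gamma a b -> smooth_curve_on delta a b.
Proof.
  intros Heq ((gx & ex & ? & ? & Ex) & (gy & ey & ? & ? & Ey) & (gz & ez & ? & ? & Ez)).
  split; [exists gx, ex|split; [exists gy, ey|exists gz, ez]];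
    (split; [easy|split; [easy|]]); intros t Ht; rewrite Heq by exact Ht; auto.
Qed.

(** Segments of constant speed N over a unit of time, the only ones needed here,
    have length N. *)
Lemma is_length_between_extend (p q v r : SOL) (L N : R) :
  is_length_between p q L ->
  affine_curve q v 0 1 = r ->
  (forall s, sol_norm (affine_curve q v 0 s) v = N) ->
  is_length_between p r (L + N).
Proof.
  intros (gamma & a & b & Hab & Hpw & Ha & Hb & ->) Hr HN.
  assert (Hshift : forall t, affine_curve q v b t = affine_curve q v 0 (t - b))
    by (intros t; unfold affine_curve; now rewrite Rminus_0_r).
  pose (delta := fun t => if Rle_dec t b then gamma t else affine_curve q v b t).
  assert (Hleft : forall t, t <= b -> delta t = gamma t)
    by (intros t Ht; unfold delta; destruct (Rle_dec t b); [easy|lra]).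
  assert (Hright : forall t, b <= t -> delta t = affine_curve q v b t).
  { intros t Ht; unfold delta; destruct (Rle_dec t b); [|easy].
    replace t with b by lra; rewrite Hb; destruct q as [[? ?] ?].
    unfold affine_curve, xcoord, ycoord, zcoord; cbn; repeat f_equal; ring. }
  pose proof (proj1 (potential_le_length _ _ _ Hpw)) as Hex.
  destruct Hpw as (n & t & H0 & Hn & Hpc).
  assert (Hsp1 : forall s, Rmin a b < s < Rmax a b -> speed gamma s = speed delta s).
  { rewrite Rmin_left, Rmax_right by lra; intros s Hs.
    apply (speed_ext_open _ _ a b); [|exact Hs].
    intros u Hu; symmetry; apply Hleft; lra. }
  assert (Hsp2 : forall s, Rmin b (b + 1) < s < Rmax b (b + 1) -> N = speed delta s).
  { rewrite Rmin_left, Rmax_right by lra; intros s Hs.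
    rewrite (speed_ext_open delta (affine_curve q v b) b (b + 1) s);
      [|intros u Hu; apply Hright; lra|exact Hs].
    now rewrite speed_affine_curve, Hshift, HN. }
  exists delta, a, (b + 1); split; [lra|split; [|split; [|split]]].
  - exists (S n), (fun i => if Nat.leb i n then t i else b + 1).
    split; [exact H0|split].
    + now rewrite (proj2 (Nat.leb_gt (S n) n)) by lia.
    + intros i Hi; rewrite (proj2 (Nat.leb_le i n)) by lia.
      destruct (Nat.eq_dec i n) as [->|Hne].
      * rewrite (proj2 (Nat.leb_gt (S n) n)), Hn by lia.
        split; [lra|].
        apply (smooth_curve_on_ext (affine_curve q v b));
          [intros s Hs; apply Hright; lra|].
        repeat split; eapply smooth_on_affine; reflexivity.
      * rewrite (proj2 (Nat.leb_le (S i) n)) by lia.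
        destruct (Hpc i) as [Hlt Hsm]; [lia|].
        split; [exact Hlt|].
        apply (smooth_curve_on_ext gamma); [|exact Hsm].
        intros s Hs; apply Hleft.
        assert (t (S i) <= t n)
          by (apply partition_le; [intros j Hj; now apply Hpc|lia]).
        lra.
  - rewrite Hleft by lra; exact Ha.
  - rewrite Hright, Hshift by lra.
    now replace (b + 1 - b) with 1 by ring.
  - change (curve_length ?g) with (RInt (speed g)).
    rewrite <- (RInt_Chasles (speed delta) a b (b + 1)).
    + rewrite <- (RInt_ext _ _ _ _ Hsp1), <- (RInt_ext _ _ _ _ Hsp2), RInt_const.
      unfold plus, scal; cbn; unfold mult; cbn; ring.
    + exact (ex_RInt_ext _ _ _ _ Hsp1 Hex).
    + exact (ex_RInt_ext _ _ _ _ Hsp2 (ex_RInt_const _ _ _)).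
Qed.

Lemma extend_vertical (p : SOL) (x y z z' L : R) :
  is_length_between p (x, y, z) L ->
  is_length_between p (x, y, z') (L + Rabs (z' - z)).
Proof.
  intros H; apply (is_length_between_extend _ _ (0, 0, z' - z) _ _ _ H).
  - unfold affine_curve, xcoord, ycoord, zcoord; cbn; repeat f_equal; ring.
  - intros s; rewrite <- sqrt_Rsqr_abs; unfold sol_norm, sol_metric, Rsqr.
    unfold xcoord, ycoord, zcoord; cbn; f_equal; ring.
Qed.

Lemma extend_along_x (p : SOL) (x x' y z L : R) :
  is_length_between p (x, y, z) L ->
  is_length_between p (x', y, z) (L + exp (- z) * Rabs (x' - x)).
Proof.
  intros H; apply (is_length_between_extend _ _ (x' - x, 0, 0) _ _ _ H).
  - unfold affine_curve, xcoord, ycoord, zcoord; cbn; repeat f_equal; ring.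
  - intros s; rewrite <- (Rabs_pos_eq (exp (- z))) by (left; apply exp_pos).
    rewrite <- Rabs_mult, <- sqrt_Rsqr_abs; unfold sol_norm, sol_metric, Rsqr.
    unfold xcoord, ycoord, zcoord, affine_curve; cbn.
    replace (z + (s - 0) * 0) with z by ring.
    replace (-2 * z) with (2 * - z) by ring; rewrite (exp_double (- z)).
    f_equal; ring.
Qed.

Lemma extend_along_y (p : SOL) (x y y' z L : R) :
  is_length_between p (x, y, z) L ->
  is_length_between p (x, y', z) (L + exp z * Rabs (y' - y)).
Proof.
  intros H; apply (is_length_between_extend _ _ (0, y' - y, 0) _ _ _ H).
  - unfold affine_curve, xcoord, ycoord, zcoord; cbn; repeat f_equal; ring.
  - intros s; rewrite <- (Rabs_pos_eq (exp z)) by (left; apply exp_pos).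
    rewrite <- Rabs_mult, <- sqrt_Rsqr_abs; unfold sol_norm, sol_metric, Rsqr.
    unfold xcoord, ycoord, zcoord, affine_curve; cbn.
    replace (z + (s - 0) * 0) with z by ring.
    rewrite (exp_double z); f_equal; ring.
Qed.

(** * Estimates of the distance *)

Lemma sol_dist_between (p q : SOL) (m L : R) :
  (forall L', is_length_between p q L' -> m <= L') ->
  is_length_between p q L -> m <= sol_dist p q <= L.
Proof.
  intros Hm HL; unfold sol_dist.
  destruct (Glb_Rbar_correct (is_length_between p q)) as [Hlb Hglb].
  specialize (Hlb L HL).
  specialize (Hglb (Finite m) Hm).
  destruct (Glb_Rbar (is_length_between p q)); cbn in *; easy || lra.
Qed.

Lemma length_of_five_segments (x y l : R) :
  0 <= x -> 0 <= y -> 0 <= l ->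
  is_length_between (0, 0, 0) (x, y, 0) (4 * l + exp (- l) * (x + y)).
Proof.
  intros Hx Hy Hl.
  pose proof (is_length_between_refl (0, 0, 0)) as H.
  apply (extend_vertical _ _ _ _ l) in H.
  apply (extend_along_x _ _ x) in H.
  apply (extend_vertical _ _ _ _ (- l)) in H.
  apply (extend_along_y _ _ _ y) in H.
  apply (extend_vertical _ _ _ _ 0) in H.
  replace (4 * l + exp (- l) * (x + y)) with
    (0 + Rabs (l - 0) + exp (- l) * Rabs (x - 0) + Rabs (- l - l)
     + exp (- l) * Rabs (y - 0) + Rabs (0 - - l)); [exact H|].
  rewrite (Rabs_left1 (- l - l)) by lra.
  rewrite !Rabs_pos_eq by lra; ring.
Qed.

(** From the origin to (x, y, 0) the potential grows by
    ln ((x^2 + 4) / 2) + ln ((y^2 + 4) / 2) - 2 ln 2. *)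
Lemma length_ge_ln (x y L : R) :
  0 < x -> 0 < y -> is_length_between (0, 0, 0) (x, y, 0) L ->
  2 * ln (x * y / 4) <= L.
Proof.
  intros Hx Hy (gamma & a & b & _ & Hpw & Ha & Hb & ->).
  destruct (potential_le_length _ _ _ Hpw) as [_ Hle].
  eapply Rle_trans; [|exact Hle]; rewrite Ha, Hb.
  unfold potential, busemann, xcoord, ycoord, zcoord; cbn [fst snd].
  rewrite Ropp_0, exp_0.
  assert (Hxy : 0 < x * y / 4) by nra.
  replace ((0 ^ 2 + (1 + 1) ^ 2) / (1 + 1)) with 2 by field.
  rewrite <- (ln_mult 2 2), <- ln_mult by nra.
  rewrite <- ln_div by nra.
  replace (2 * ln (x * y / 4)) with (ln (x * y / 4 * (x * y / 4)))
    by (rewrite ln_mult by lra; ring).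
  apply ln_le; nra.
Qed.

Theorem theorem5p6 (theta : R) (htheta : 0 < theta < PI / 2) :
  exists C : R,
    Rbar_locally p_infty (fun lambda : R =>
      Rabs (sol_dist (0, 0, 0) (lambda * cos theta, lambda * sin theta, 0)
            - 4 * ln lambda) <= C).
Proof.
  assert (Hc : 0 < cos theta) by (apply cos_gt_0; lra).
  assert (Hs : 0 < sin theta) by (apply sin_gt_0; lra).
  set (k := cos theta * sin theta / 4).
  assert (Hk : 0 < k) by (unfold k; nra).
  (* Above, the two horizontal segments cost cos theta + sin theta <= 2; below,
     the potential gives 4 ln lambda + 2 ln k. *)
  exists (2 + 2 * Rabs (ln k)), 1; intros lambda Hl.
  assert (Hx : 0 < lambda * cos theta) by nra.
  assert (Hy : 0 < lambda * sin theta) by nra.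
  assert (Hln : 0 <= ln lambda) by (rewrite <- ln_1; apply ln_le; lra).
  destruct (sol_dist_between (0, 0, 0) (lambda * cos theta, lambda * sin theta, 0)
    _ _ (fun L => length_ge_ln _ _ L Hx Hy)
    (length_of_five_segments _ _ (ln lambda) (Rlt_le _ _ Hx) (Rlt_le _ _ Hy) Hln))
    as [Hlo Hup].
  rewrite exp_Ropp, exp_ln in Hup by lra.
  replace (/ lambda * (lambda * cos theta + lambda * sin theta))
    with (cos theta + sin theta) in Hup by (field; lra).
  replace (lambda * cos theta * (lambda * sin theta) / 4)
    with (lambda * lambda * k) in Hlo by (unfold k; field).
  rewrite !ln_mult in Hlo by nra.
  pose proof (COS_bound theta); pose proof (SIN_bound theta).
  pose proof (Rabs_maj2 (ln k)); pose proof (Rabs_pos (ln k)).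
  apply Rabs_le; lra.
Qed.
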